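(* For $n>0$ (with $k\ge 0$ and $p$ integers), $$N_O(n,k,p)=2\left[\binom{n-1}{p}^2-\sum_{i=0}^{k-2}N_i^{n-1,p}\right],$$ where the sum is taken to be $0$ if $k<2$.
   Context: A lattice path of length $n$ here is a path in the plane starting at the origin $(0,0)$ and consisting of $n$ unit steps, each either E $=(1,0)$ or N $=(0,1)$. Let $M_{r,s}^{n,k}$ be the number of ordered pairs of lattice paths of length $n$ such that the first path ends at $(r,n-r)$, the second path ends at $(s,n-s)$, and the two paths intersect exactly $k$ times, where intersections at the origin and at the endpoints of the paths are not counted; that is, there are exactly $k$ indices $m$ with $1\le m\le n-1$ such that the two paths are at the same lattice point after $m$ steps. ($M_{r,s}^{n,k}=0$ unless $0\le r,s\le n$.) Put $N_k^{n,r}=M_{r,r}^{n,k}$. For an integer $p$ define $$N_O(n,k,p)=\sum_{r+s=2p+1} M_{r,s}^{n,k},$$ where the sum is over all ordered pairs of integers $(r,s)$ with $r+s=2p+1$. Binomial coefficients $\binom{a}{b}$ are $0$ unless $0\le b\le a$.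
   Formalization: The single case n=1, k=1, p=0 is excluded, because there the formula fails: paths of length 1 have no interior point, so N_O(1,1,0)=0, while the right-hand side equals 2. *)

(* Defs.v *)
From mathcomp Require Import all_boot all_order all_algebra.
From mathcomp Require Import boolp classical_sets functions cardinality fsbigop.

Set Implicit Arguments.
Unset Strict Implicit.
Unset Printing Implicit Defensive.

Import Order.TTheory GRing.Theory Num.Theory.
Local Open Scope ring_scope.

(* A lattice path of length n is its sequence of n steps, [true] standing for
   E = (1, 0) and [false] for N = (0, 1). *)
Definition lpath (n : nat) := n.-tuple bool.

Definition step (b : bool) : int * int := if b then (1, 0) else (0, 1).

(* The lattice point reached after the first m steps, starting from (0, 0). *)
Definition point_at (w : seq bool) (m : nat) : int * int :=
  \sum_(b <- take m w) step b.

(* The number of m with 1 <= m <= n - 1 at which the two paths meet; the upper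
   bound is carried by the type 'I_n of m. *)
Definition intersections (n : nat) (u v : lpath n) : nat :=
  #|[pred m : 'I_n | (1 <= m)%N && (point_at u m == point_at v m)]|.

Definition M (n k : nat) (r s : int) : nat :=
  #|[pred uv : lpath n * lpath n |
      [&& point_at uv.1 n == (r, n%:Z - r),
          point_at uv.2 n == (s, n%:Z - s) &
          intersections uv.1 uv.2 == k]]|.

Definition N (n k : nat) (r : int) : nat := M n k r r.

(* The sum is over all integer pairs on the line; it has finite support, as
   [M n k r s] vanishes unless 0 <= r, s <= n. *)
Definition N_O (n k : nat) (p : int) : int :=
  \sum_(rs \in [set rs : int * int | rs.1 + rs.2 = 2 * p + 1]%classic)
    (M n k rs.1 rs.2)%:Z.

(* Binomial coefficient with an integer lower index, 0 if it is negative. *)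
Definition binz (a : nat) (b : int) : nat :=
  if b is Posz b' then 'C(a, b') else 0%N.

(* A path of length 1 has no interior point. Since the right-hand side of the
   formula for [N_O 1 1 0] is 2 * 'C(0, 0) ^ 2 = 2, this case is exceptional. *)
Lemma N_O_1_1_0 : N_O 1 1 0 = 0.
Proof.
apply: fsbig1 => -[r s] _ /=; rewrite /M eq_card0 // => -[u v].
rewrite !inE /intersections eq_card0 ?andbF // => m.
by rewrite !inE (ord1 m).
Qed.

(* Main.v *)
Require Import Defs.
From mathcomp Require Import all_boot all_order all_algebra.
From mathcomp Require Import classical_sets fsbigop.
From mathcomp Require Import zify ring.

(** Follow the horizontal gap between the two paths: it is a walk on the
    integers that is at 0 exactly when the paths meet. Let [nwalks n k d t] be
    the number of pairs of length n starting at gap d, with t east steps in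
    total and k times at gap 0, and let [nbridges n k d t] be the number of those
    that end at gap 0 after more than k times at gap 0 (times 0 and n included).
    When t - d is odd, so that the final gap is not 0,
      [nwalks n.+1 k.+1 d t = 2 * nbridges n k d (t - 1)],
    by induction on n: both sides satisfy the same recurrence on the first step,
    except at k = d = 0, where one needs the ballot-type identity
      [nwalks n 0 (d + 1) t =
         nwalks n 0 d t + nbridges n 0 d t + nbridges n 0 (d + 1) t]  (d >= 0),
    itself a consequence of the recurrence and the symmetry d -> -d. At d = 0
    and t = 2p + 1 the left-hand side is N_O(n+1, k, p), and for n > 0 the
    right-hand side counts, twice, the pairs of length n ending at (p, n-p) with
    at least k - 1 interior intersections. *)

Set Implicit Arguments.
Unset Strict Implicit.
Unset Printing Implicit Defensive.

Import Order.TTheory GRing.Theory Num.Theory.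
Local Open Scope ring_scope.

(** * Counting words over a finite alphabet *)

Definition nwords (T : finType) (n : nat) (P : pred (seq T)) : nat :=
  #|[pred w : n.-tuple T | P w]|.

Lemma eq_nwords (T : finType) n (P Q : pred (seq T)) :
  (forall w, size w = n -> P w = Q w) -> nwords n P = nwords n Q.
Proof. by move=> PQ; apply: eq_card => w; rewrite !inE PQ ?size_tuple. Qed.

Lemma nwords0 (T : finType) (P : pred (seq T)) : nwords 0 P = P [::].
Proof.
rewrite /nwords; case P0: (P [::]); last first.
  by rewrite eq_card0 // => w; rewrite !inE tuple0 P0.
rewrite (eq_card (B := predT)); first by rewrite card_tuple.
by move=> w; rewrite !inE tuple0 P0.
Qed.

Lemma nwordsS (T : finType) n (P : pred (seq T)) :
  nwords n.+1 P = (\sum_x nwords n (fun w => P (x :: w)))%N.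
Proof.
rewrite /nwords -sum1_card.
under [RHS]eq_bigr => x _ do rewrite -sum1_card.
rewrite pair_big_dep /=.
rewrite (reindex (fun xw : T * n.-tuple T => [tuple of xw.1 :: xw.2])) /=.
  by apply: eq_big => -[x w].
exists (fun w => (thead w, [tuple of behead w])).
  by move=> [x w] _; congr pair; apply: val_inj.
by move=> w _; case/tupleP: w => x w; apply: val_inj.
Qed.

Lemma nwords_map (T : finType) n (f : T -> T) (P : pred (seq T)) :
  injective f -> nwords n (fun w => P (map f w)) = nwords n P.
Proof.
move=> f_inj; rewrite /nwords -!sum1_card.
rewrite [RHS](reindex_inj (h := fun w : n.-tuple T => [tuple of map f w])) //.
by move=> u v /(congr1 val) /(inj_map f_inj) /val_inj.
Qed.

(** * Gap walks and their first-step recurrences *)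

Definition step_gap (x : bool * bool) : int := x.1%:Z - x.2%:Z.
Definition step_east (x : bool * bool) : int := x.1%:Z + x.2%:Z.

Definition end_gap (d : int) w : int := d + \sum_(x <- w) step_gap x.
Definition east_total w : int := \sum_(x <- w) step_east x.

Fixpoint visits (d : int) (w : seq (bool * bool)) : nat :=
  ((d == 0%R) + (if w is x :: w' then visits (d + step_gap x)%R w' else 0))%N.

Definition nwalks n k d t :=
  nwords n (fun w => (visits d w == k) && (east_total w == t)).
Definition nbridges n k d t :=
  nwords n (fun w => [&& k < visits d w, east_total w == t & end_gap d w == 0])%N.

Arguments nwalks (n k)%_nat_scope (d t)%_ring_scope.
Arguments nbridges (n k)%_nat_scope (d t)%_ring_scope.

Lemma east_total_cons x w t : (east_total (x :: w) == t) = (east_total w == t - step_east x).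
Proof. by rewrite /east_total big_cons [RHS]eq_sym subr_eq [RHS]eq_sym addrC. Qed.

Lemma end_gap_cons d x w : end_gap d (x :: w) = end_gap (d + step_gap x) w.
Proof. by rewrite /end_gap big_cons addrA. Qed.

(** Time 0 is itself a visit when [d] is 0; the index [(d == 0) + k] treats both cases at once. *)
Lemma nwalksS (n k : nat) (d t : int) : nwalks n.+1 ((d == 0%R) + k)%N d t =
  (\sum_x nwalks n k (d + step_gap x) (t - step_east x))%N.
Proof.
rewrite /nwalks nwordsS; apply: eq_bigr => x _.
by apply: eq_nwords => w _; rewrite east_total_cons /= eqn_add2l.
Qed.

Lemma nbridgesS (n k : nat) (d t : int) : nbridges n.+1 ((d == 0%R) + k)%N d t =
  (\sum_x nbridges n k (d + step_gap x) (t - step_east x))%N.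
Proof.
rewrite /nbridges nwordsS; apply: eq_bigr => x _.
by apply: eq_nwords => w _; rewrite east_total_cons end_gap_cons /= ltn_add2l.
Qed.

Lemma nwalks00 n t : nwalks n 0 0 t = 0%N.
Proof. by rewrite /nwalks /nwords eq_card0 // => -[[|x w] i]; rewrite !inE. Qed.

Lemma visits_end_gap d w : end_gap d w = 0 -> (0 < visits d w)%N.
Proof.
elim: w d => [|x w IH] d; first by rewrite /end_gap big_nil addr0 => ->.
by rewrite end_gap_cons /= => /IH; case: (d == 0).
Qed.

(** Ending at gap 0 is already a visit, so the bound on visits is automatic. *)
Lemma nbridges0E n d t : nbridges n 0 d t =
  nwords n (fun w => (east_total w == t) && (end_gap d w == 0)).
Proof.
apply: eq_nwords => w _; case: (end_gap d w =P 0) => [/visits_end_gap ->|]; first by [].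
by rewrite !andbF.
Qed.

(** At [d = 0], [nbridgesS] reaches only positive indices; this supplies the missing index 0. *)
Lemma nbridges0S n d t : nbridges n.+1 0 d t =
  (\sum_x nbridges n 0 (d + step_gap x) (t - step_east x))%N.
Proof.
rewrite nbridges0E nwordsS; apply: eq_bigr => x _; rewrite nbridges0E.
by apply: eq_nwords => w _; rewrite east_total_cons end_gap_cons.
Qed.

Lemma nwalks_len0 k d t :
  nwalks 0 k d t = ((d == 0%R) + 0 == k)%N && (t == 0) :> nat.
Proof. by rewrite /nwalks nwords0 /= /east_total big_nil [0 == t]eq_sym. Qed.

Lemma nbridges_len0 k d t :
  nbridges 0 k d t = [&& k == 0%N, t == 0 & d == 0] :> nat.
Proof.
rewrite /nbridges nwords0 /= /east_total /end_gap !big_nil addr0 [0 == t]eq_sym.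
by case: (d == 0); case: k => [|[]] //=; rewrite !andbF.
Qed.

Lemma sum_steps (F : int -> int -> nat) (d t : int) :
  (\sum_x F (d + step_gap x)%R (t - step_east x)%R =
   F d (t - 2)%R + F (d + 1)%R (t - 1)%R + F (d - 1)%R (t - 1)%R + F d t)%N.
Proof.
rewrite (eq_bigr (fun x => F (d + step_gap (x.1, x.2)) (t - step_east (x.1, x.2))))
  => [|[a b] _ //].
rewrite -(pair_bigA _ (fun a b => F (d + step_gap (a, b)) (t - step_east (a, b)))).
rewrite big_bool !big_bool /= !addnA /step_gap /step_east /=.
by congr (F _ _ + F _ _ + F _ _ + F _ _)%N; lia.
Qed.

(** * Symmetry under exchanging the two paths *)

Definition swap (x : bool * bool) := (x.2, x.1).

Lemma swap_inj : injective swap.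
Proof. by move=> [a b] [c d] [-> ->]. Qed.

Lemma step_gap_swap x : step_gap (swap x) = - step_gap x.
Proof. by rewrite /step_gap opprB. Qed.

Lemma east_total_swap w : east_total (map swap w) = east_total w.
Proof. by rewrite /east_total big_map; apply: eq_bigr => x _; rewrite /step_east addrC. Qed.

Lemma end_gap_swap d w : end_gap (- d) (map swap w) = - end_gap d w.
Proof.
rewrite /end_gap big_map opprD -sumrN; congr (_ + _).
by apply: eq_bigr => x _; rewrite step_gap_swap.
Qed.

Lemma visits_swap d w : visits (- d) (map swap w) = visits d w.
Proof.
elim: w d => [|x w IH] d /=; rewrite oppr_eq0 //.
by rewrite step_gap_swap -opprD IH.
Qed.

Lemma nwalksN n k d t : nwalks n k (- d) t = nwalks n k d t.
Proof.
rewrite /nwalks -(nwords_map _ _ swap_inj); apply: eq_nwords => w _.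
by rewrite visits_swap east_total_swap.
Qed.

Lemma nbridgesN n k d t : nbridges n k (- d) t = nbridges n k d t.
Proof.
rewrite /nbridges -(nwords_map _ _ swap_inj); apply: eq_nwords => w _.
by rewrite visits_swap east_total_swap end_gap_swap oppr_eq0.
Qed.

(** * Parity, the ballot-type identity and the bridge formula *)

Lemma nbridges_odd n k d t q : t = d + 2 * q + 1 -> nbridges n k d t = 0%N.
Proof.
move=> ->; rewrite /nbridges /nwords eq_card0 // => w; rewrite !inE.
apply/negP => /and3P[_ /eqP tw /eqP fw].
(* Here [r] is the number of east steps of the second path; hence a walk ending at gap 0 has an east
   total of the parity of [d]. *)
suff [r]: exists r : int, east_total w = end_gap d w - d + 2 * r by rewrite tw fw; lia.
rewrite /east_total /end_gap; elim: (tval w) => [|x v [r Hr]].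
  by exists 0; rewrite !big_nil; lia.
exists (r + x.2%:Z); rewrite !big_cons Hr /step_east /step_gap; ring.
Qed.

Lemma nwalks_avoid n (d : nat) t : nwalks n 0 d.+1 t =
  (nwalks n 0 d t + nbridges n 0 d t + nbridges n 0 d.+1 t)%N.
Proof.
elim: n d t => [|n IH] d t.
  rewrite !nwalks_len0 !nbridges_len0 /=.
  by case: d => [|d]; rewrite /= ?andbF ?andbT ?addn0 ?add0n.
have e1 (a : nat) : a.+1%:Z + 1 = a.+2 by lia.
have e2 (a : nat) : a.+1%:Z - 1 = a by lia.
have E (a : nat) := nwalksS n 0 a.+1 t; rewrite /= in E.
rewrite !E !nbridges0S !sum_steps !e1 !e2 !IH; case: d => [|d]; last first.
  by rewrite !E !sum_steps !e1 !e2 !IH; lia.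
(* From gap 0 the bridges also pass through gap -1; symmetry folds that term onto gap 1. *)
rewrite !nwalks00 (_ : 0%N%:Z + 1 = 1%N) // (_ : 0%N%:Z - 1 = - 1%N%:Z) // nbridgesN; lia.
Qed.

Lemma nwalks_nbridges n k d t q : t = d + 2 * q + 1 ->
  nwalks n.+1 k.+1 d t = (2 * nbridges n k d (t - 1))%N.
Proof.
elim: n k d t q => [|n IH] k d t q tE.
  rewrite nbridges_len0; have [d0|d0] := eqVneq d 0; last first.
    have := nwalksS 0 k.+1 d t; rewrite (negbTE d0) add0n => ->.
    rewrite big1 ?andbF // => -[a b] _; rewrite nwalks_len0.
    (* A nonzero term would need [d = - step_gap x] and [t = step_east x], making [t - d] even. *)
    by case: eqP => [/eqP|]; case: eqP; rewrite /step_gap /step_east /=; lia.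
  have := nwalksS 0 k d t; rewrite d0 eqxx add1n => ->.
  rewrite sum_steps !nwalks_len0; lia.
(* Every step preserves the parity of [t - d], so the induction hypothesis stays applicable. *)
have stepE x : t - step_east x = d + step_gap x + 2 * (q - x.1%:Z) + 1.
  by rewrite tE /step_east /step_gap; lia.
have tC x : t - step_east x - 1 = t - 1 - step_east x by lia.
have [d0|d0] := eqVneq d 0; last first.
  have := nwalksS n.+1 k.+1 d t; rewrite (negbTE d0) add0n => ->.
  have := nbridgesS n k d (t - 1); rewrite (negbTE d0) add0n => ->.
  rewrite big_distrr /=; apply: eq_bigr => x _.
  by rewrite (IH _ _ _ _ (stepE x)) tC.
have := nwalksS n.+1 k d t; rewrite d0 eqxx add1n => ->.
case: k => [|k]; last first.
  have := nbridgesS n k d (t - 1); rewrite d0 eqxx add1n => ->.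
  rewrite big_distrr /=; apply: eq_bigr => x _.
  by rewrite -d0 (IH _ _ _ _ (stepE x)) tC.
(* With no later visit allowed, the first step leads to gap 1 or -1, equally often: this is the
   factor 2. The ballot-type identity at gap 0 then leaves one bridge term, the one from gap 1
   vanishing by parity. *)
rewrite sum_steps (_ : 0 + 1 = 1%N%:Z) // (_ : 0 - 1 = - 1%N%:Z) // nwalksN !nwalks00.
rewrite (nwalks_avoid _ 0) nwalks00 (@nbridges_odd _ _ 1 _ (q - 1)); last lia.
by rewrite !addn0 !add0n mul2n -addnn.
Qed.

(** * Translating pairs of lattice paths into gap walks *)

Lemma fsbig_card_fibers (T : finType) (J : choiceType) (f : T -> J)
    (A : set J) (P : pred T) :
  \sum_(j \in A) #|[pred x | (f x == j) && P x]|%:Z =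
  #|[pred x | (f x \in A) && P x]|%:Z.
Proof.
(* [A] may be infinite, but only the finitely many values of [f] in it contribute. *)
pose r := [seq j <- undup (map f (enum T)) | j \in A].
have ur : uniq r by rewrite filter_uniq ?undup_uniq.
have mem_r x : f x \in r = (f x \in A).
  by rewrite mem_filter mem_undup map_f ?mem_enum ?andbT.
rewrite (fsbigE r) //; first last.
- move=> j Aj jr; rewrite eq_card0 // => x; rewrite !inE.
  by apply/negP => /andP[/eqP fx _]; move: jr; rewrite -fx mem_r fx mem_set.
- by move=> j; rewrite /= mem_filter => /andP[/set_mem].
rewrite -(big_morph Posz PoszD (erefl _)) -sum1_card; congr Posz.
under eq_bigr => j _ do rewrite -sum1_card.
rewrite (exchange_big_dep [pred x | (f x \in A) && P x]) /=; last first.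
  by move=> j x jA /andP[/eqP ->]; rewrite jA.
apply: eq_bigr => x /andP[fxA Px].
rewrite (eq_bigl (pred1 (f x))); last first.
  move=> j /=; rewrite !inE Px andbT [j == _]eq_sym.
  by case: eqP => [<-|]; rewrite ?fxA ?andbF.
by rewrite sum1_count count_uniq_mem // mem_r fxA.
Qed.

Lemma nwords_zip (S T : finType) n (P : pred (seq (S * T))) :
  nwords n P =
  #|[pred uv : n.-tuple S * n.-tuple T | P (zip uv.1 uv.2)]|.
Proof.
rewrite /nwords -!sum1_card.
rewrite (reindex (fun uv : n.-tuple S * n.-tuple T => [tuple of zip uv.1 uv.2])) //=.
exists (fun w : n.-tuple (S * T) => ([tuple of map fst w], [tuple of map snd w])).
  by move=> [u v] _; congr pair; apply: val_inj;
     rewrite /= -/unzip1 -/unzip2 ?unzip1_zip ?unzip2_zip ?size_tuple.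
by move=> w _; apply: val_inj; exact: zip_unzip.
Qed.

Lemma east_total_zip u v : size u = size v ->
  east_total (zip u v) = (count id u)%:Z + (count id v)%:Z.
Proof.
rewrite /east_total; elim: u v => [|a u IH] [|b v] //=; first by rewrite big_nil.
by case=> /IH; rewrite big_cons /step_east => -> /=; lia.
Qed.

Lemma end_gap_zip d u v : size u = size v ->
  end_gap d (zip u v) = d + (count id u)%:Z - (count id v)%:Z.
Proof.
rewrite /end_gap -addrA => uv; congr (d + _).
elim: u v uv => [|a u IH] [|b v] //=; first by rewrite big_nil.
by case=> /IH; rewrite big_cons /step_gap => -> /=; lia.
Qed.

Lemma take_zip (S T : Type) (u : seq S) (v : seq T) m :
  take m (zip u v) = zip (take m u) (take m v).
Proof. by elim: m u v => [|m IH] [|a u] [|b v] //=; rewrite IH. Qed.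

Lemma point_atE w m :
  point_at w m = ((count id (take m w))%:Z, (count negb (take m w))%:Z).
Proof.
rewrite /point_at; elim: (take m w) => [|b v IH]; first by rewrite big_nil.
rewrite big_cons IH /= !PoszD.
by case: b; rewrite /step /=; congr pair; rewrite /= ?add0r.
Qed.

(** Both prefixes have the same length, so equal east counts force equal north counts. *)
Lemma point_at_eq u v m : size u = size v ->
  (point_at u m == point_at v m) = (end_gap 0 (take m (zip u v)) == 0).
Proof.
move=> uv; rewrite take_zip end_gap_zip ?size_take ?uv // !point_atE.
have countNE (w : seq bool) : (count id w + count negb w = size w)%N := count_predC id w.
have := countNE (take m u); have := countNE (take m v).
rewrite !size_take uv => <- H; rewrite add0r subr_eq0 xpair_eqE /=.
by apply/andP/eqP => [[/eqP]//|[e]]; split; apply/eqP; lia.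
Qed.

Lemma visitsE d w : visits d w = (\sum_(m < (size w).+1) (end_gap d (take m w) == 0%R))%N.
Proof.
elim: w d => [|x w IH] d.
  by rewrite /= big_ord_recl big_ord0 /end_gap big_nil addr0.
rewrite [LHS]/= IH [RHS]big_ord_recl take0 {2}/end_gap big_nil addr0; congr (_ + _)%N.
by apply: eq_bigr => m _; rewrite /= end_gap_cons.
Qed.

(** The successor accounts for the origin and the boolean for the endpoint, which are distinct times
    since [n] is positive. *)
Lemma visits_zip n (u v : lpath n) : (0 < n)%N ->
  visits 0 (zip u v) = (intersections u v + (end_gap 0 (zip u v) == 0%R)).+1.
Proof.
case: n u v => // n u v _.
rewrite visitsE size_zip !size_tuple minnn big_ord_recr take_oversize; last first.
  by rewrite size_zip !size_tuple minnn.
rewrite -addSn; congr (_ + _)%N.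
rewrite /intersections -sum1_card [in RHS]big_mkcond [in RHS]big_ord_recl /= add0n.
rewrite big_ord_recl take0 {1}/end_gap big_nil addr0 eqxx add1n; congr _.+1.
by apply: eq_bigr => m _; rewrite inE /= point_at_eq ?size_tuple.
Qed.

Lemma point_at_end n (w : lpath n) r :
  (point_at w n == (r, n%:Z - r)) = ((count id w)%:Z == r).
Proof.
have countNE : (count id w + count negb w = size w)%N := count_predC id w.
rewrite point_atE take_oversize ?size_tuple // xpair_eqE -[X in X%:Z - r](size_tuple w).
rewrite -countNE PoszD; have [<-|//] := eqVneq _ r.
by rewrite addrC addKr eqxx.
Qed.

Lemma M_card n k r s : M n k r s =
  #|[pred uv : lpath n * lpath n |
      (((count id uv.1)%:Z, (count id uv.2)%:Z) == (r, s)) &&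
      (intersections uv.1 uv.2 == k)]|.
Proof.
apply: eq_card => -[u v].
by rewrite !inE !point_at_end xpair_eqE andbA.
Qed.

Lemma N_O_nwalks n k p : N_O n.+1 k p = (nwalks n.+1 k.+1 0 (2 * p + 1))%:Z.
Proof.
rewrite /N_O; under eq_fsbigr => rs _ do rewrite M_card.
rewrite (fsbig_card_fibers (fun uv : lpath n.+1 * lpath n.+1 =>
  ((count id uv.1)%:Z, (count id uv.2)%:Z)) _ (fun uv => intersections uv.1 uv.2 == k)).
rewrite /nwalks nwords_zip; congr Posz; apply: eq_card => -[u v].
rewrite !inE /= visits_zip // east_total_zip ?end_gap_zip ?size_tuple //.
rewrite andbC; set c := (_ : int) + (count id v)%:Z.
have -> : (((count id u)%:Z, (count id v)%:Z)
    \in [set rs | rs.1 + rs.2 = 2 * p + 1]%classic) = (c == 2 * p + 1).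
  by apply/idP/eqP => [/set_mem|cE]; last exact: mem_set.
have [cE|] := eqVneq c (2 * p + 1); last by rewrite !andbF.
rewrite !andbT; case: (_ =P 0) => [|_]; last by rewrite addn0.
(* An odd sum of east counts keeps the endpoints apart, so the origin is the only visit beyond the
   interior ones. *)
suff odd_sum (a b : int) : a + b = 2 * p + 1 -> 0 + a - b <> 0.
  by move=> e; case: (odd_sum _ _ cE e).
by lia.
Qed.

(** * Binomial counts and the final formula *)

Lemma card_count n p :
  #|[pred u : lpath n | (count id u)%:Z == p]| = binz n p.
Proof.
rewrite -[LHS]/(nwords n (fun u => (count id u)%:Z == p)).
elim: n p => [|n IH] p; first by rewrite nwords0 /=; case: p => [[]|].
rewrite nwordsS big_bool /=.
have -> : nwords n (fun w : seq bool => (true + count id w)%N%:Z == p) = binz n (p - 1).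
  by rewrite -IH; apply: eq_nwords => w _; lia.
have -> : nwords n (fun w : seq bool => (false + count id w)%N%:Z == p) = binz n p.
  by rewrite -IH.
by case: p => [[|p]|p] //=; rewrite ?bin0 // subn1 /= binS addnC.
Qed.

(** All pairs with both east counts [p] are sorted by number of intersections, those with at least
    [K] being kept together. *)
Lemma binz_sqr n K p : (binz n p ^ 2 = \sum_(i < K) N n i p +
  #|[pred uv : lpath n * lpath n | [&& (count id uv.1)%:Z == p,
      (count id uv.2)%:Z == p & K <= intersections uv.1 uv.2]]|)%N.
Proof.
elim: K => [|K ->].
  by rewrite big_ord0 -mulnn -card_count -cardX; apply: eq_card => uv; rewrite !inE andbT.
rewrite big_ord_recr -addnA /N M_card; congr (_ + _)%N.
rewrite -[LHS](cardID [pred uv | intersections uv.1 uv.2 == K]); congr (_ + _)%N.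
  apply: eq_card => uv; rewrite !inE xpair_eqE /=; lia.
apply: eq_card => uv; rewrite !inE /=; lia.
Qed.

(* The range i < k.-1 is 0 <= i <= k - 2, and is empty for k < 2. *)
Theorem theorem2 (n k : nat) (p : int) (hn : (0 < n)%N)
    (hexc : ~ (n = 1%N /\ k = 1%N /\ p = 0)) :
  N_O n k p =
    2 * ((binz n.-1 p)%:Z ^+ 2 - \sum_(i < k.-1) (N n.-1 i p)%:Z).
Proof.
case: n hn hexc => // n _ hexc /=.
rewrite N_O_nwalks (@nwalks_nbridges _ _ _ _ p) ?add0r // addrK.
rewrite -[_ ^+ 2]/((binz n p ^ 2)%N%:Z) (binz_sqr n k.-1).
rewrite -(big_morph Posz PoszD (erefl _)) PoszD addrAC subrr add0r PoszM.
congr (_ * Posz _); rewrite /nbridges nwords_zip; apply: eq_card => -[u v].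
rewrite !inE /= east_total_zip ?end_gap_zip ?size_tuple //.
case: n u v hexc => [|n] u v hexc.
  (* For empty paths origin and endpoint are a single visit, so [k < 1] faces [k.-1 <= 0]; these
     differ only at [k = 1], where [hexc] rules out [p = 0]. *)
  rewrite (tuple0 u) (tuple0 v) /= /intersections eq_card0; last by case.
  by case: k hexc => [|[|k]]; lia.
(* A bridge visits 0 at both ends, so [k] is below the interior count plus 2, that is, [k.-1] is at
   most that count; gap 0 and total [2 * p] make both east counts [p]. *)
rewrite visits_zip // end_gap_zip ?size_tuple //; lia.
Qed.
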